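(* Let $C$ be a finite set of $m$ candidates, let $k \in \{1,\dots,m\}$ be a committee size with $k \le 7$, and let $P$ be a profile over $C$. Then every local PAV committee $W \subseteq C$ with $|W| = k$ for the profile $P$ is core stable, i.e., it is in the core.
   Context: Let $\mathcal{A}$ be the set of non-empty subsets of $C$; its elements are called ballots. A profile is a map $P : \mathcal{A} \to \mathbb{Q}_{\ge 0}$ with $\sum_{A \in \mathcal{A}} P(A) = 1$. A committee is a subset $W \subseteq C$ with $|W| = k$. For a ballot $A$ and a set $X \subseteq C$, let $u_A(X) = |A \cap X|$. A potential deviation is a non-empty set $T \subseteq C$ with $|T| \le k$. It is a (successful) deviation from the committee $W$ (under $P$) if $\sum_{A \in \mathcal{A} : u_A(T) > u_A(W)} P(A) \ge \frac{|T|}{k}$. A committee $W$ is core stable if no potential deviation is a deviation from $W$, i.e. $\sum_{A \in \mathcal{A} : u_A(T) > u_A(W)} P(A) < \frac{|T|}{k}$ for every potential deviation $T$. The core (of $P$, for size $k$) is the set of core-stable committees. Let $H(n) = 1 + \frac12 + \cdots + \frac1n$ (with $H(0)=0$). The PAV score of a set $X \subseteq C$ is $\mathrm{PAV}_P(X) = \sum_{A \in \mathcal{A}} P(A) \cdot H(u_A(X))$. A committee $W$ is a local PAV committee if for all $x \in W$ and $y \in C \setminus W$ we have $\mathrm{PAV}_P((W \setminus \{x\}) \cup \{y\}) \le \mathrm{PAV}_P(W)$. *)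

(* Defs.v *)
From mathcomp Require Import all_boot all_order all_algebra.

Set Implicit Arguments.
Unset Strict Implicit.
Unset Printing Implicit Defensive.

Import Order.TTheory GRing.Theory Num.Theory.

Local Open Scope ring_scope.

Definition ballot (C : finType) := {A : {set C} | A != set0}.

Definition is_profile (C : finType) (P : ballot C -> rat) : Prop :=
  (forall A, 0 <= P A) /\ \sum_A P A = 1.

Definition committee (C : finType) (k : nat) (W : {set C}) : bool := #|W| == k.

Definition util (C : finType) (A : ballot C) (X : {set C}) : nat :=
  #|val A :&: X|.

Definition potential_deviation (C : finType) (k : nat) (T : {set C}) : bool :=
  (T != set0) && (#|T| <= k)%N.

Definition deviation (C : finType) (k : nat) (P : ballot C -> rat)
    (W T : {set C}) : bool :=
  \sum_(A | (util A W < util A T)%N) P A >= #|T|%:R / k%:R.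

Definition core_stable (C : finType) (k : nat) (P : ballot C -> rat)
    (W : {set C}) : bool :=
  [forall T : {set C}, potential_deviation k T ==> ~~ deviation k P W T].

Definition core (C : finType) (k : nat) (P : ballot C -> rat) : {set {set C}} :=
  [set W | committee k W & core_stable k P W].

Definition harmonic (n : nat) : rat := \sum_(1 <= i < n.+1) i%:R^-1.

Definition PAV (C : finType) (P : ballot C -> rat) (X : {set C}) : rat :=
  \sum_A P A * harmonic (util A X).

Definition local_PAV (C : finType) (k : nat) (P : ballot C -> rat)
    (W : {set C}) : Prop :=
  committee k W /\
  forall x y : C, x \in W -> y \notin W ->
    PAV P ((W :\ x) :|: [set y]) <= PAV P W.

(* Main.v *)
(** Let [T] be a deviation from [W] and sum the PAV change over all swaps of
    some [x] in [W :\: T] against some [y] in [T :\: W].  A voter approving [a]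
    candidates of [W :&: T], [b] of [W :\: T] and [c] of [T :\: W] contributes
    [c (p - b) / (a + b + 1) - b (r - c) / (a + b)] to the total change, where
    [s], [p], [r] are the sizes of these three sets.  This is never below [- r],
    and, when [k = s + p <= 7], it exceeds [r k / (s + r) - r] for each voter who
    prefers [T], that is, with [b < c].  As these voters have weight at
    least [(s + r) / k], the total change is positive, so some swap improves the
    PAV score. *)
Require Import Defs.
From mathcomp Require Import all_boot all_order all_algebra.
From mathcomp Require Import zify ring lra.

Set Implicit Arguments.
Unset Strict Implicit.
Unset Printing Implicit Defensive.

Import Order.TTheory GRing.Theory Num.Theory.

Local Open Scope ring_scope.

Definition total_swap_gain (p r a b c : nat) : rat :=
  (c * (p - b))%N%:R / (a + b).+1%:R - (b * (r - c))%N%:R / (a + b)%N%:R.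

(** The gain term is nonnegative, and the loss term is at most [r] because [b <= a + b] and
    [r - c <= r]; when [a + b = 0] the quotient is [0] by convention. *)
Lemma total_swap_gain_ge (p r a b c : nat) : - r%:R <= total_swap_gain p r a b c.
Proof.
rewrite /total_swap_gain.
have h1 : 0 <= (c * (p - b))%N%:R / (a + b).+1%:R :> rat.
  by rewrite divr_ge0 ?ler0n.
suff h2 : (b * (r - c))%N%:R / (a + b)%N%:R <= r%:R :> rat.
  by move: h1 h2; set y := _ / _; set z := _ / _; lra.
have [->|u0] := posnP (a + b); first by rewrite invr0 mulr0 ler0n.
rewrite ler_pdivrMr ?ltr0n // -natrM ler_nat mulnC leq_mul ?leq_subr //.
exact: leq_addl.
Qed.

(** For [k = s + p], [r k / (s + r) - r] equals [r (p - r) / (s + r)]. Clearing denominators leaves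
    an inequality in [nat], to be computed on finitely many tuples. *)
Definition small_gain_check : bool :=
  all (fun s => all (fun p => all (fun r => all (fun a => all (fun b => all
    (fun c =>
      (r * (p - r) * maxn (a + b) 1 + b * (r - c) * (s + r)) * (a + b).+1
        < c * (p - b) * maxn (a + b) 1 * (s + r))%N
    (iota b.+1 (r - b))) (iota 0 r)) (iota 0 s.+1)) (iota 1 p))
    (iota 0 (8 - s))) (iota 0 8).

Lemma small_gain_check_true : small_gain_check.
Proof. by vm_compute. Qed.

(* [maxn (a + b) 1] clears the denominator [a + b] also when it is [0], where
   the corresponding term of [total_swap_gain] vanishes because [b = 0]. *)
Lemma small_gain_nat (s p r a b c : nat) :
    (s + p <= 7)%N -> (r <= p)%N -> (a <= s)%N -> (b < c)%N -> (c <= r)%N ->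
  ((r * (p - r) * maxn (a + b) 1 + b * (r - c) * (s + r)) * (a + b).+1
     < c * (p - b) * maxn (a + b) 1 * (s + r))%N.
Proof.
move=> sp7 rp as_ bc cr; have := small_gain_check_true.
move=> /allP/(_ s); rewrite mem_iota => /(_ ltac:(lia)).
move=> /allP/(_ p); rewrite mem_iota => /(_ ltac:(lia)).
move=> /allP/(_ r); rewrite mem_iota => /(_ ltac:(lia)).
move=> /allP/(_ a); rewrite mem_iota => /(_ ltac:(lia)).
move=> /allP/(_ b); rewrite mem_iota => /(_ ltac:(lia)).
by move=> /allP/(_ c); rewrite mem_iota => /(_ ltac:(lia)).
Qed.

Lemma total_swap_gain_improver (s p r a b c : nat) :
    (s + p <= 7)%N -> (r <= p)%N -> (a <= s)%N -> (b < c)%N -> (c <= r)%N ->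
  r%:R * ((s + p)%N%:R / (s + r)%N%:R) - r%:R < total_swap_gain p r a b c.
Proof.
move=> sp7 rp as_ bc cr; have := small_gain_nat sp7 rp as_ bc cr.
set v := maxn (a + b) 1 => ineq.
have v0 : (0 < v)%N by rewrite /v; lia.
have r0 : (0 < s + r)%N by lia.
have vE : (b * (r - c))%N%:R / (a + b)%N%:R = (b * (r - c))%N%:R / v%:R :> rat.
  have [ab0|ab0] := posnP (a + b); last by rewrite /v (maxn_idPl ab0).
  by have -> : b = 0%N by [lia]; rewrite mul0n !mul0r.
rewrite /total_swap_gain vE.
have -> : r%:R * ((s + p)%N%:R / (s + r)%N%:R) - r%:R
          = (r * (p - r))%N%:R / (s + r)%N%:R :> rat.
  have n0 : (s + r)%N%:R != 0 :> rat by rewrite pnatr_eq0 -lt0n.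
  apply: (mulIf n0); rewrite mulrBl mulrA !divfK // -!natrM -natrB.
    by rewrite -mulnBr subnDl.
  by rewrite leq_mul2l leq_add2l rp orbT.
rewrite ltrBrDr addf_div ?pnatr_eq0 -?lt0n //.
rewrite ltr_pdivrMr ?mulr_gt0 ?ltr0n // mulrAC ltr_pdivlMr ?ltr0n //.
rewrite -!natrM -natrD -natrM ltr_nat.
by rewrite [X in (_ < _ * X)%N]mulnC mulnA.
Qed.

Lemma harmonicS (n : nat) : harmonic n.+1 = harmonic n + n.+1%:R^-1.
Proof. by rewrite /harmonic big_nat_recr. Qed.

(** The utility changes only when the ballot contains exactly one of [x] and [y], and then by one,
    so a single harmonic term is gained or lost. *)
Lemma harmonic_swap (C : finType) (A : ballot C) (W : {set C}) (x y : C) :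
    x \in W -> y \notin W ->
  harmonic (util A ((W :\ x) :|: [set y])) - harmonic (util A W)
  = ((x \notin val A) && (y \in val A))%:R / (util A W).+1%:R
    - ((x \in val A) && (y \notin val A))%:R / (util A W)%:R.
Proof.
move=> xW yW.
have yWx : y \notin W :\ x by rewrite inE (negPf yW) andbF.
have uW : util A W = ((x \in val A) + #|val A :&: (W :\ x)|)%N.
  rewrite /util (cardsD1 x) !inE xW andbT; congr (_ + _)%N.
  by apply: eq_card => z; rewrite !inE; case: (z == x); rewrite ?andbF.
have uW' : util A ((W :\ x) :|: [set y])
           = ((y \in val A) + #|val A :&: (W :\ x)|)%N.
  rewrite /util (cardsD1 y) !inE eqxx orbT andbT; congr (_ + _)%N.
  apply: eq_card => z; rewrite !inE.
  by have [->|] := eqVneq z y; rewrite ?(negPf yW) ?andbF ?orbF.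
rewrite uW uW'; set n := #|_|.
by case: (x \in _); case: (y \in _); rewrite /= ?add0n ?add1n ?harmonicS; ring.
Qed.

Lemma sum_pair_indicator (R : pzSemiRingType) (I J : finType)
    (D : {set I}) (E : {set J})
    (f : pred I) (g : pred J) :
  \sum_(x in D) \sum_(y in E) (f x && g y)%:R
  = (#|[set x in D | f x]| * #|[set y in E | g y]|)%N%:R :> R.
Proof.
have count (K : finType) (F : {set K}) (h : pred K) :
    #|[set z in F | h z]|%:R = \sum_(z in F) (h z)%:R :> R.
  rewrite -sum1_card natr_sum (eq_bigl (fun z => (z \in F) && h z)); last first.
    by move=> z; rewrite inE.
  by rewrite big_mkcondr /=; apply: eq_bigr => z _; case: (h z).
rewrite natrM !count big_distrl /=; apply: eq_bigr => x _.
by rewrite big_distrr /=; apply: eq_bigr => y _; rewrite -mulnb natrM.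
Qed.

(** Of the pairs [(x, y)], [(p - b) c] have only [y] approved and [b (r - c)] only [x]; the
    denominators depend on [util A W = a + b] alone. *)
Lemma sum_harmonic_swap (C : finType) (A : ballot C) (W T : {set C}) :
  \sum_(x in W :\: T) \sum_(y in T :\: W)
     (harmonic (util A ((W :\ x) :|: [set y])) - harmonic (util A W))
  = total_swap_gain #|W :\: T| #|T :\: W| #|val A :&: (W :&: T)|
      #|val A :&: (W :\: T)| #|val A :&: (T :\: W)|.
Proof.
have uW : util A W = (#|val A :&: (W :&: T)| + #|val A :&: (W :\: T)|)%N.
  by rewrite /util -(cardsID T (val A :&: W)) -setIA -setIDA.
have inA (F : {set C}) : #|[set z in F | z \in val A]| = #|val A :&: F|.
  by apply: eq_card => z; rewrite !inE andbC.
have outA (F : {set C}) :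
    #|[set z in F | z \notin val A]| = (#|F| - #|val A :&: F|)%N.
  rewrite -(cardsID (val A) F) setIC addKn.
  by apply: eq_card => z; rewrite !inE andbC.
rewrite /total_swap_gain -uW -outA -outA -!inA [X in X%:R / _.+1%:R - _]mulnC.
rewrite -!sum_pair_indicator !mulr_suml -sumrB; apply: eq_bigr => x.
rewrite inE => /andP[_ xW]; rewrite !mulr_suml -sumrB; apply: eq_bigr => y.
by rewrite inE => /andP[yW _]; rewrite harmonic_swap.
Qed.

(** With the sum over ballots moved inside, each pair [(x, y)] contributes the PAV change of one
    swap. *)
Lemma local_PAV_sum_swaps (C : finType) (k : nat) (P : ballot C -> rat)
    (W T : {set C}) :
    local_PAV k P W ->
  \sum_A P A * (\sum_(x in W :\: T) \sum_(y in T :\: W)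
     (harmonic (util A ((W :\ x) :|: [set y])) - harmonic (util A W))) <= 0.
Proof.
case=> _ opt.
under eq_bigr do rewrite mulr_sumr.
rewrite exchange_big /=; apply: sumr_le0 => x; rewrite inE => /andP[_ xW].
under eq_bigr do rewrite mulr_sumr.
rewrite exchange_big /=; apply: sumr_le0 => y; rewrite inE => /andP[yW _].
under eq_bigr do rewrite mulrBr.
by rewrite sumrB subr_le0; apply: opt.
Qed.

Theorem theorem4p1 (C : finType) (m : nat) (hm : #|C| = m)
    (k : nat) (hk1 : (1 <= k)%N) (hkm : (k <= m)%N) (hk7 : (k <= 7)%N)
    (P : ballot C -> rat) (hP : is_profile P)
    (W : {set C}) (hW : local_PAV k P W) :
  W \in core k P.
Proof.
have Wk : #|W| = k by case: hW => /eqP.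
rewrite inE /committee Wk eqxx; apply/forallP => T; apply/implyP.
case/andP=> T0 Tk; apply/negP; rewrite /deviation => dev.
case: hP => P0 P1.
have t0 : (0 < #|T|)%N by rewrite card_gt0.
have Ws : (#|W :&: T| + #|W :\: T|)%N = k by rewrite cardsID.
have Ts : (#|W :&: T| + #|T :\: W|)%N = #|T| by rewrite setIC cardsID.
pose imp A := (util A W < util A T)%N.
have impE A : imp A = (#|val A :&: (W :\: T)| < #|val A :&: (T :\: W)|)%N.
  rewrite /imp /util -(cardsID T (val A :&: W)) -(cardsID W (val A :&: T)).
  by rewrite -!setIA -!setIDA [T :&: W]setIC ltn_add2l.
have := local_PAV_sum_swaps T hW.
under eq_bigr do rewrite sum_harmonic_swap.
(* Scaled so that supporters of weight exactly [#|T| / k] contribute [#|T :\: W|] in total. *)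
pose q : rat := #|T :\: W|%:R * (k%:R / #|T|%:R).
pose gain (A : ballot C) := total_swap_gain #|W :\: T| #|T :\: W| #|val A :&: (W :&: T)|
      #|val A :&: (W :\: T)| #|val A :&: (T :\: W)|.
rewrite -/gain; apply/negP; rewrite -ltNge.
have gain_imp A : imp A -> q - #|T :\: W|%:R < gain A.
  rewrite impE => bc; rewrite /q -Ts -Ws; apply: total_swap_gain_improver => //.
  - by rewrite Ws.
  - by lia.
  - exact: subset_leq_card (subsetIr _ _).
  - exact: subset_leq_card (subsetIr _ _).
(* Each gain is its lower bound plus a surplus; as [P] sums to 1, the lower bounds add up to the
   first summand. *)
have gainE : \sum_A P A * gain A
    = (q * (\sum_(A | imp A) P A) - #|T :\: W|%:R)
      + (\sum_(A | imp A) P A * (gain A - (q - #|T :\: W|%:R))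
         + \sum_(A | ~~ imp A) P A * (gain A + #|T :\: W|%:R)).
  set n := #|T :\: W|%:R.
  have nE : n = \sum_(A | imp A) P A * n + \sum_(A | ~~ imp A) P A * n.
    by rewrite -[LHS]mul1r -P1 (bigID imp) mulrDl !mulr_suml.
  rewrite [X in _ - X + _]nE opprD [_ * _ + _]addrA mulr_sumr -sumrB.
  rewrite addrACA -sumrN -!big_split (bigID imp) /=.
  by congr (_ + _); apply: eq_bigr => A _; ring.
have k0 : 0 < k%:R :> rat by rewrite ltr0n.
have t0' : 0 < #|T|%:R :> rat by rewrite ltr0n.
have main_ge0 : 0 <= q * (\sum_(A | imp A) P A) - #|T :\: W|%:R.
  rewrite subr_ge0.
  have -> : #|T :\: W|%:R = q * (#|T|%:R / k%:R).
    by rewrite /q; field; rewrite !gt_eqF.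
  by rewrite ler_wpM2l // /q !mulr_ge0 ?invr_ge0 ?ler0n.
(* Strictness comes from here: the supporters have positive weight, so one of them has [P A > 0] and
   a strictly positive surplus. *)
have imp_gt0 : 0 < \sum_(A | imp A) P A * (gain A - (q - #|T :\: W|%:R)).
  have : 0 < \sum_(A | imp A) P A by apply: lt_le_trans dev; rewrite divr_gt0.
  rewrite lt_def psumr_neq0 => [/andP[/hasP[A _ /andP[iA PA]] _]|A _]; last exact: P0.
  rewrite (bigD1 A) //= ltr_pwDl ?mulr_gt0 ?subr_gt0 ?gain_imp //.
  apply: sumr_ge0 => B /andP[iB _].
  by rewrite mulr_ge0 ?P0 // subr_ge0 ltW // gain_imp.
have rest_ge0 : 0 <= \sum_(A | ~~ imp A) P A * (gain A + #|T :\: W|%:R).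
  apply: sumr_ge0 => A _; rewrite mulr_ge0 ?P0 // -lerBlDr sub0r.
  exact: total_swap_gain_ge.
by rewrite gainE ltr_wpDl // ltr_pwDl.
Qed.
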